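(* Let $p$ be a prime, let $r\ge 1$ and $\alpha_1,\dots,\alpha_r\ge 1$ be integers, let $G=\mathbb{Z}_{p^{\alpha_1}}\oplus\cdots\oplus\mathbb{Z}_{p^{\alpha_r}}$ be a $p$-group of rank $r$, and let $h=\sum_{i=1}^r\alpha_i$. Let $s\ge 0$ be an integer and suppose that $p^h>\sum_{j=1}^r p^s(p^{\alpha_j}-1)$. Then $$\mathsf{EGZ}(p^h,G,p^s)=p^h+\mathsf{D}(G,p^s)-p^s.$$
   Context: $G=\mathbb{Z}_{p^{\alpha_1}}\oplus\cdots\oplus\mathbb{Z}_{p^{\alpha_r}}$ is regarded as a finite commutative ring with coordinate-wise operations. A sequence $S$ over $G$ is a finite sequence of elements of $G$, order disregarded and repetition allowed (i.e. a finite multiset); its length $|S|$ is the number of its elements counted with multiplicity; a subsequence is a sub-multiset. For a positive integer $m$ and a sequence $S=(g_1,\dots,g_\ell)$ over $G$, $$e_m(S)=\sum_{1\le i_1<\cdots<i_m\le \ell}\ \prod_{j=1}^m g_{i_j}\in G$$ (an empty sum is $0$). $\mathsf{D}(G,m)$ denotes the smallest positive integer $z$ such that every sequence $S$ over $G$ of length $|S|\ge z$ contains a subsequence $S'$ of length $|S'|\ge m$ with $e_m(S')=0$. $\mathsf{EGZ}(t,G,m)$ denotes the smallest positive integer $z$ such that every sequence $S$ over $G$ of length $|S|\ge z$ contains a subsequence $S'$ of length exactly $t$ with $e_m(S')=0$; if no such $z$ exists, $\mathsf{EGZ}(t,G,m)=\infty$. *)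

(* Defs.v *)
From HB Require Import structures.
From mathcomp Require Import all_boot all_order all_fingroup all_algebra.
From mathcomp Require Import boolp.

Set Implicit Arguments.
Unset Strict Implicit.
Unset Printing Implicit Defensive.
Local Set Warnings "-redundant-canonical-projection".

Import GRing.Theory.
Local Open Scope ring_scope.

(* The direct sum of the rings Z/p^(alpha i)Z, i < r, with coordinate-wise
   operations.  'Z_n is Z/nZ only for n > 1, so this is the intended ring when
   p is prime and every alpha i is positive. *)
Definition psum (p r : nat) (alpha : 'I_r -> nat) : Type :=
  {dffun forall i : 'I_r, 'Z_(p ^ alpha i)}.

Section PsumRing.
Variables (p r : nat) (alpha : 'I_r -> nat).
Local Notation G := (psum p alpha).

HB.instance Definition _ :=
  Finite.copy G {dffun forall i : 'I_r, 'Z_(p ^ alpha i)}.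

Definition psum_mk (f : forall i : 'I_r, 'Z_(p ^ alpha i)) : G := finfun f.
Definition psum_zero : G := psum_mk (fun _ => 0).
Definition psum_one : G := psum_mk (fun _ => 1).
Definition psum_opp (x : G) : G := psum_mk (fun i => - x i).
Definition psum_add (x y : G) : G := psum_mk (fun i => x i + y i).
Definition psum_mul (x y : G) : G := psum_mk (fun i => x i * y i).

Fact psum_addA : associative psum_add.
Proof. by move=> x y z; apply/ffunP=> i; rewrite !ffunE addrA. Qed.
Fact psum_addC : commutative psum_add.
Proof. by move=> x y; apply/ffunP=> i; rewrite !ffunE addrC. Qed.
Fact psum_add0 : left_id psum_zero psum_add.
Proof. by move=> x; apply/ffunP=> i; rewrite !ffunE add0r. Qed.
Fact psum_addN : left_inverse psum_zero psum_opp psum_add.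
Proof. by move=> x; apply/ffunP=> i; rewrite !ffunE addNr. Qed.

HB.instance Definition _ :=
  GRing.isZmodule.Build G psum_addA psum_addC psum_add0 psum_addN.

Fact psum_mulA : associative psum_mul.
Proof. by move=> x y z; apply/ffunP=> i; rewrite !ffunE mulrA. Qed.
Fact psum_mulC : commutative psum_mul.
Proof. by move=> x y; apply/ffunP=> i; rewrite !ffunE mulrC. Qed.
Fact psum_mul1 : left_id psum_one psum_mul.
Proof. by move=> x; apply/ffunP=> i; rewrite !ffunE mul1r. Qed.
Fact psum_mulDl : left_distributive psum_mul psum_add.
Proof. by move=> x y z; apply/ffunP=> i; rewrite !ffunE mulrDl. Qed.

HB.instance Definition _ :=
  GRing.Zmodule_isComPzRing.Build G psum_mulA psum_mulC psum_mul1 psum_mulDl.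

Lemma psum0E i : (0 : G) i = 0. Proof. by rewrite ffunE. Qed.
Lemma psum1E i : (1 : G) i = 1. Proof. by rewrite ffunE. Qed.
Lemma psumDE (x y : G) i : (x + y) i = x i + y i.
Proof. by rewrite ffunE. Qed.
Lemma psumME (x y : G) i : (x * y) i = x i * y i.
Proof. by rewrite ffunE. Qed.

End PsumRing.

(* Finite multisets are represented by lists; [elem_sym] only depends on the
   underlying multiset ([elem_sym_perm]). *)
Definition submultiset (T : eqType) (S' S : seq T) : Prop :=
  forall x, (count_mem x S' <= count_mem x S)%N.

(* e_m(S); the index tuples i_1 < ... < i_m are the m-subsets of 'I_(size S). *)
Definition elem_sym (R : comPzRingType) (m : nat) (S : seq R) : R :=
  \sum_(A : {set 'I_(size S)} | #|A| == m) \prod_(i in A) S`_i.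

Lemma elem_sym_perm (R : comPzRingType) (m : nat) (S1 S2 : seq R) :
  perm_eq S1 S2 -> elem_sym m S1 = elem_sym m S2.
Proof.
move=> eqS; have eq_sz := perm_size eqS.
have /tuple_permP[s defS1] : perm_eq S1 (in_tuple S2) by [].
pose f (i : 'I_(size S1)) : 'I_(size S2) := s (cast_ord eq_sz i).
have f_inj : injective f by move=> i j /perm_inj /cast_ord_inj.
have f_nth (i : 'I_(size S1)) : S1`_i = S2`_(f i).
  have -> : S1`_i = [tuple tnth (in_tuple S2) (s i) | i < size S2]`_i.
    by rewrite -defS1.
  rewrite -[nat_of_ord i]/(nat_of_ord (cast_ord eq_sz i)) -tnth_nth tnth_mktuple.
  by rewrite (tnth_nth 0).
pose g (i : 'I_(size S2)) : 'I_(size S1) := cast_ord (esym eq_sz) (s^-1%g i).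
have fK : cancel f g by move=> i; rewrite /f /g permK cast_ordK.
have gK : cancel g f by move=> i; rewrite /f /g cast_ordKV permKV.
rewrite /elem_sym (reindex (fun A : {set 'I_(size S1)} => f @: A)) /=; last first.
  exists (fun B : {set 'I_(size S2)} => g @: B) => A _.
    by rewrite -imset_comp (eq_imset _ (g := id)) ?imset_id.
  by rewrite -imset_comp (eq_imset _ (g := id)) ?imset_id.
apply: eq_big => [A | A _]; first by rewrite card_imset.
rewrite big_imset /=; last by move=> i j _ _ /f_inj.
by apply: eq_bigr => i _; rewrite f_nth.
Qed.

(* The smallest positive integer satisfying P; [None] (i.e. infinity) if there
   is none. *)
Definition least_pos (P : nat -> Prop) : option nat :=
  if pselect (exists n, (0 < n)%N && `[< P n >]) is left exP
  then Some (ex_minn exP) else None.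

Lemma least_pos_Some (P : nat -> Prop) (n : nat) :
  least_pos P = Some n <->
  [/\ (0 < n)%N, P n & forall k, (0 < k)%N -> P k -> (n <= k)%N].
Proof.
rewrite /least_pos; case: pselect => [exP | nexP]; last first.
  split=> // -[n_gt0 Pn _]; case: nexP; exists n; rewrite n_gt0 /=.
  exact/asboolP.
case: ex_minnP => m /andP[m_gt0 /asboolP Pm] min_m; split=> [[<-] | ].
  by split=> // k k_gt0 Pk; apply: min_m; rewrite k_gt0; apply/asboolP.
case=> n_gt0 Pn min_n; congr Some; apply/eqP.
rewrite eqn_leq min_n // andbT; apply: min_m; rewrite n_gt0 /=.
exact/asboolP.
Qed.

Lemma least_pos_None (P : nat -> Prop) :
  least_pos P = None <-> (forall n, (0 < n)%N -> ~ P n).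
Proof.
rewrite /least_pos; case: pselect => [exP | nexP]; split=> //.
  by case: ex_minnP => n /andP[n_gt0 /asboolP Pn] _ nP; case: (nP n n_gt0 Pn).
by move=> _ n n_gt0 Pn; case: nexP; exists n; rewrite n_gt0; apply/asboolP.
Qed.

Definition davenport (G : comPzRingType) (m : nat) : option nat :=
  least_pos (fun z => forall S : seq G, (z <= size S)%N ->
    exists S' : seq G,
      [/\ submultiset S' S, (m <= size S')%N & elem_sym m S' = 0]).

Definition EGZ (t : nat) (G : comPzRingType) (m : nat) : option nat :=
  least_pos (fun z => forall S : seq G, (z <= size S)%N ->
    exists S' : seq G,
      [/\ submultiset S' S, size S' = t & elem_sym m S' = 0]).

(* Main.v *)
Require Import Defs.
From mathcomp Require Import all_boot all_order all_fingroup all_algebra.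

(** Put [m = p ^ s] and [N = \sum_j m (p ^ alpha_j - 1)]; then [D(G, m) = m + N]
    and [EGZ(p ^ h, G, m) = p ^ h + N].

    For the upper bounds, let [S] have length [l > p ^ k - 1 + N].  Modulo [p],
    the indicator of [p ^ a | n] is [\sum_(j < p ^ a) (-1)^j binomial(n, j)].
    As a function of the subset [A] of indices, the indicator of "[p ^ k]
    divides [#|A|] and [e_m(S_A) = 0]" is therefore, modulo [p], a combination of
    indicators of [B \subset A] with [#|B| < l], so its alternating sum over
    all [A] vanishes.  It is [1] at the empty set, hence nonzero at some
    nonempty [A].  Taking [k = s] forces [#|A| >= m]; taking [k = h] and
    [l = p ^ h + N < 2 p ^ h] forces [#|A| = p ^ h].

    For the lower bounds, let [g_j = (0, ..., 0, 1, ..., 1)] with the first [1]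
    in position [j], and take [m (p ^ alpha_j - 1)] copies of each [g_j],
    [m - 1] further copies of [g_0], and [p ^ h - m] zeros in the case of
    [EGZ]. *)

Set Implicit Arguments.
Unset Strict Implicit.
Unset Printing Implicit Defensive.

Import GRing.Theory.
Local Open Scope ring_scope.

(** * Divisibility by prime powers in terms of binomial coefficients modulo [p] *)

(** Since [j * 'C(p ^ a, j) = p ^ a * 'C(p ^ a - 1, j - 1)], a binomial prime to [p] would force
    [p ^ a] to divide [j]. *)
Lemma prime_dvd_bin_exp (p a j : nat) :
  prime p -> (0 < j < p ^ a)%N -> (p %| 'C(p ^ a, j))%N.
Proof.
case: j => // j p_pr /= j_lt; apply: contraTT j_lt => pnC.
rewrite -leqNgt dvdn_leq //.
have cop : coprime (p ^ a) 'C(p ^ a, j.+1) by rewrite coprimeXl // prime_coprime.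
by rewrite -(Gauss_dvdl _ cop) -mul_bin_diag dvdn_mulr.
Qed.

(** The expansion of [(1 - 1) ^ n], cut off after its first [q] terms. *)
Definition alt_bin (R : comPzRingType) (q n : nat) : R :=
  \sum_(k < q) (-1) ^+ k * 'C(n, k)%:R.

Lemma alt_bin_small (R : comPzRingType) (q n : nat) :
  (n < q)%N -> alt_bin R q n = (n == 0%N)%:R.
Proof.
move=> n_lt; rewrite -(expr0n R) -(subrr 1) exprBn.
rewrite (big_ord_widen_cond _ xpredT
  (fun i => (-1) ^+ i * 1 ^+ (n - i) * 1 ^+ i *+ 'C(n, i)) n_lt).
rewrite /alt_bin [RHS]big_mkcond /=.
apply: eq_bigr => k _; rewrite !expr1n !mulr1 mulr_natr ltnS.
by case: leqP => // /bin_small ->; rewrite mulr0n.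
Qed.

(** In Vandermonde's expansion of ['C(p ^ a + n, k)] with [k < p ^ a], every term containing
    ['C(p ^ a, i)] with [0 < i <= k] vanishes modulo [p]. *)
Lemma alt_bin_period (p a n : nat) :
  prime p -> alt_bin 'F_p (p ^ a) (n + p ^ a) = alt_bin 'F_p (p ^ a) n.
Proof.
move=> p_pr; rewrite /alt_bin; apply: eq_bigr => k _; congr (_ * _).
rewrite addnC -binomial.Vandermonde natr_sum big_ord_recl bin0 mul1n subn0.
rewrite big1 ?addr0 // => i _; apply/eqP.
rewrite natrM mulf_eq0 -(dvdn_pcharf (pchar_Fp p_pr)) prime_dvd_bin_exp //.
by rewrite /= (leq_ltn_trans _ (ltn_ord k)) // lift0.
Qed.

Lemma alt_bin_dvd (p a n : nat) :
  prime p -> alt_bin 'F_p (p ^ a) n = (p ^ a %| n)%:R.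
Proof.
move=> p_pr; have q_gt0 : (0 < p ^ a)%N by rewrite expn_gt0 prime_gt0.
rewrite {1}(divn_eq n (p ^ a)) addnC.
elim: (n %/ _)%N => [|k IHk]; last by rewrite mulSnr addnA alt_bin_period.
by rewrite addn0 alt_bin_small ?ltn_mod.
Qed.

(** * Degrees of functions on the subsets of a finite set *)

Section SetDegree.
Variables (R : comPzRingType) (T : finType).
Implicit Types (f g : {set T} -> R) (A B : {set T}).

(** The indicator of [B \subset A] is the monomial [\prod_(x in B) [x \in A]], so this is the degree
    of a multilinear polynomial on the cube of subsets of [T]. *)
Definition set_degree_le (d : nat) f : Prop :=
  exists2 c : {set T} -> R, (forall B, (d < #|B|)%N -> c B = 0)
    & forall A, f A = \sum_(B : {set T} | B \subset A) c B.

Lemma eq_set_degree_le d f g :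
  f =1 g -> set_degree_le d f -> set_degree_le d g.
Proof. by move=> fg [c c0 fE]; exists c => // A; rewrite -fg. Qed.

Lemma set_degree_leW d e f :
  (d <= e)%N -> set_degree_le d f -> set_degree_le e f.
Proof.
by move=> de [c c0 fE]; exists c => // B /(leq_ltn_trans de) /c0.
Qed.

Lemma set_degree_le_subset (a : R) B :
  set_degree_le #|B| (fun A => a * (B \subset A)%:R).
Proof.
exists (fun C => if C == B then a else 0) => [C|A].
  by case: eqP => // ->; rewrite ltnn.
rewrite -big_mkcondr; case: (boolP (B \subset A)) => BA.
  rewrite (big_pred1 B) ?mulr1 // => C /=.
  by rewrite andbC; case: eqP => // ->.
by rewrite mulr0 big1 // => C /andP[CA /eqP CB]; rewrite -CB CA in BA.
Qed.

Lemma set_degree_le_const (a : R) d : set_degree_le d (fun=> a).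
Proof.
apply: (@set_degree_leW #|@set0 T|); first by rewrite cards0.
apply: eq_set_degree_le (set_degree_le_subset a set0) => A.
by rewrite sub0set mulr1.
Qed.

Lemma set_degree_leD d f g :
  set_degree_le d f -> set_degree_le d g -> set_degree_le d (fun A => f A + g A).
Proof.
move=> [b b0 fE] [c c0 gE]; exists (fun B => b B + c B) => [B dB|A].
  by rewrite b0 // c0 // addr0.
by rewrite fE gE big_split.
Qed.

(** The indicators of [B \subset A] and [C \subset A] multiply to that of [B :|: C \subset A], and
    [#|B :|: C| <= #|B| + #|C|]. *)
Lemma set_degree_leM d e f g :
  set_degree_le d f -> set_degree_le e g ->
  set_degree_le (d + e) (fun A => f A * g A).
Proof.
move=> [b b0 fE] [c c0 gE].
exists (fun D => \sum_(B : {set T}) \sum_(C : {set T} | B :|: C == D)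
  b B * c C) => [D deD|A].
  apply: big1 => B _; apply: big1 => C /eqP BCD.
  case: (leqP #|B| d) => [dB|/b0->]; last by rewrite mul0r.
  case: (leqP #|C| e) => [eC|/c0->]; last by rewrite mulr0.
  move: deD; rewrite -BCD ltnNge (leq_trans (leq_card_setU _ _)) //.
  exact: leq_add.
rewrite fE gE big_distrl /= exchange_big /= big_mkcond /=.
apply: eq_bigr => B _.
under [RHS]eq_bigr do rewrite big_mkcond /=.
rewrite exchange_big /=; under [RHS]eq_bigr do rewrite -big_mkcondr /=.
rewrite [RHS](eq_bigr (fun C : {set T} =>
  if (B \subset A) && (C \subset A) then b B * c C else 0)).
  case: (B \subset A); first by rewrite big_distrr /= big_mkcond.
  by rewrite big1.
move=> C _; rewrite -subUset; case: (boolP (B :|: C \subset A)) => BCA.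
  rewrite (big_pred1 (B :|: C)) // => D /=.
  by rewrite eq_sym andbC; case: eqP => // ->.
rewrite big1 // => D /andP[DA /eqP BCD].
by rewrite BCD DA in BCA.
Qed.

Lemma set_degree_le_sum d (I : Type) (r : seq I) (P : pred I)
    (F : I -> {set T} -> R) :
  (forall i, P i -> set_degree_le d (F i)) ->
  set_degree_le d (fun A => \sum_(i <- r | P i) F i A).
Proof.
move=> dF; elim: r => [|i r IHr].
  by apply: eq_set_degree_le (set_degree_le_const 0 d) => A; rewrite big_nil.
case Pi: (P i); last first.
  by apply: eq_set_degree_le IHr => A; rewrite big_cons Pi.
apply: eq_set_degree_le (set_degree_leD (dF i Pi) IHr) => A.
by rewrite big_cons Pi.
Qed.

Lemma set_degree_le_prod (I : Type) (r : seq I) (d : I -> nat)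
    (F : I -> {set T} -> R) :
  (forall i, set_degree_le (d i) (F i)) ->
  set_degree_le (\sum_(i <- r) d i) (fun A => \prod_(i <- r) F i A).
Proof.
move=> dF; elim: r => [|i r IHr].
  by apply: eq_set_degree_le (set_degree_le_const 1 _) => A; rewrite big_nil.
rewrite big_cons; apply: eq_set_degree_le (set_degree_leM (dF i) IHr) => A.
by rewrite big_cons.
Qed.

(** Some [x] lies outside [B]; toggling it pairs supersets of [B] of opposite signs. *)
Lemma sum_sign_supset B : (#|B| < #|T|)%N ->
  \sum_(A : {set T} | B \subset A) (-1) ^+ #|A| = 0 :> R.
Proof.
rewrite -cardsT ltnNge; case: (boolP (setT \subset B)) => [/subset_leq_card->//|].
case/subsetPn=> x _ xB _.
rewrite (bigID (fun A : {set T} => x \in A)) /=.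
rewrite (reindex_onto (fun A => x |: A) (fun A => A :\ x)) /=; last first.
  by move=> A /andP[_ xA]; rewrite setD1K.
rewrite -[X in _ + X]opprK -sumrN; apply/eqP; rewrite subr_eq0; apply/eqP.
have xD A : ((x |: A) :\ x == A) = (x \notin A).
  by apply/eqP/idP => [<-|/setU1K//]; rewrite setD11.
apply: eq_big => [A|A /andP[_]]; last first.
  by rewrite xD => xA; rewrite cardsU1 xA exprS mulN1r.
rewrite xD setU11 andbT; congr (_ && _).
by rewrite -subDset (setDidPl _) // disjoint_sym disjoints1.
Qed.

Lemma set_degree_alternating_sum d f : set_degree_le d f -> (d < #|T|)%N ->
  \sum_(A : {set T}) (-1) ^+ #|A| * f A = 0.
Proof.
move=> [c c0 fE] dT; under eq_bigr do rewrite fE big_distrr /= big_mkcond.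
rewrite exchange_big /= big1 // => B _; rewrite -big_mkcond -big_distrl /=.
case: (leqP #|B| d) => [dB|/c0->]; last exact: mulr0.
by rewrite sum_sign_supset ?mul0r // (leq_ltn_trans dB).
Qed.

(** Bounding all binomials at once makes the notion stable under sums, by Vandermonde. [F] has
    natural values because ['C(n, k)] modulo [p] is not determined by [n] modulo [p]. *)
Definition bin_degree_le (m : nat) (F : {set T} -> nat) : Prop :=
  forall k, set_degree_le (m * k) (fun A => 'C(F A, k)%:R).

(** For [0 < k] the binomial is the constant ['C(n, k)] times the indicator of [B \subset A], of
    degree at most [m <= m * k]. *)
Lemma bin_degree_le_subset (m n : nat) B :
  (#|B| <= m)%N -> bin_degree_le m (fun A => n * (B \subset A))%N.
Proof.
move=> Bm [|k].
  by apply: eq_set_degree_le (set_degree_le_const 1 _) => A; rewrite bin0.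
apply: (@set_degree_leW #|B|); first by rewrite (leq_trans Bm) // leq_pmulr.
apply: eq_set_degree_le (set_degree_le_subset ('C(n, k.+1)%:R) B) => A.
by case: (B \subset A); rewrite ?muln1 ?mulr1 // muln0 bin0n mulr0.
Qed.

Lemma bin_degree_leD m F1 F2 : bin_degree_le m F1 -> bin_degree_le m F2 ->
  bin_degree_le m (fun A => F1 A + F2 A)%N.
Proof.
move=> d1 d2 k.
apply: (@eq_set_degree_le _ (fun A =>
    \sum_(j < k.+1) 'C(F1 A, j)%:R * 'C(F2 A, k - j)%:R)) => [A|].
  by rewrite -binomial.Vandermonde natr_sum; apply: eq_bigr => j _; rewrite natrM.
apply: set_degree_le_sum => j _; have <- : (m * j + m * (k - j) = m * k)%N.
  by rewrite -mulnDr subnKC // -ltnS ltn_ord.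
exact: set_degree_leM.
Qed.

Lemma bin_degree_le_sum m (I : Type) (r : seq I) (P : pred I)
    (F : I -> {set T} -> nat) :
  (forall i, P i -> bin_degree_le m (F i)) ->
  bin_degree_le m (fun A => \sum_(i <- r | P i) F i A)%N.
Proof.
move=> dF; elim: r => [|i r IHr] k.
  apply: eq_set_degree_le (set_degree_le_const 'C(0, k)%:R _) => A.
  by rewrite big_nil.
case Pi: (P i); last first.
  by apply: eq_set_degree_le (IHr k) => A; rewrite big_cons Pi.
apply: eq_set_degree_le (bin_degree_leD (dF i Pi) IHr k) => A.
by rewrite big_cons Pi.
Qed.

Lemma set_degree_le_alt_bin m q F : bin_degree_le m F ->
  set_degree_le (m * (q - 1)) (fun A => alt_bin R q (F A)).
Proof.
move=> dF; apply: set_degree_le_sum => k _; rewrite -[(m * _)%N]add0n.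
apply: set_degree_leM; first exact: set_degree_le_const.
by apply: set_degree_leW (dF k); rewrite leq_mul // subn1 -ltnS (ltn_predK (ltn_ord k)).
Qed.
End SetDegree.

(** * Nonempty subsets satisfying divisibility conditions *)

Lemma exists_subset_dvd (p k m r : nat) (T : finType) (a : 'I_r -> nat)
    (w : 'I_r -> {set T} -> nat) :
  prime p -> (0 < m)%N ->
  (p ^ k - 1 + \sum_(i < r) m * (p ^ a i - 1) < #|T|)%N ->
  exists2 A : {set T}, A != set0 & (p ^ k %| #|A|)%N /\
    forall i, (p ^ a i %|
      \sum_(B : {set T} | (B \subset A) && (#|B| == m)) w i B)%N.
Proof.
move=> p_pr m_gt0 ltT.
pose E i (A : {set T}) :=
  (\sum_(B : {set T} | (B \subset A) && (#|B| == m)) w i B)%N.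
(* By [alt_bin_dvd], [f] is the indicator with values in ['F_p] of the sets that meet every
   divisibility condition. *)
pose f (A : {set T}) :=
  alt_bin 'F_p (p ^ k) #|A| * \prod_(i < r) alt_bin 'F_p (p ^ a i) (E i A).
have deg_card : bin_degree_le 'F_p 1 (fun A : {set T} => #|A|).
  move=> j; apply: (@eq_set_degree_le _ _ _ (fun A : {set T} =>
      'C(\sum_(x : T) 1 * ([set x] \subset A), j)%:R)) => [A|].
    rewrite -sum1_card [in RHS]big_mkcond /=; congr ('C(_, j)%:R).
    by apply: eq_bigr => x _; rewrite sub1set; case: (x \in A).
  apply: bin_degree_le_sum => x _; apply: bin_degree_le_subset.
  by rewrite cards1.
have deg_E i : bin_degree_le 'F_p m (E i).
  move=> j; apply: (@eq_set_degree_le _ _ _ (fun A : {set T} =>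
      'C(\sum_(B : {set T} | #|B| == m) w i B * (B \subset A), j)%:R)) => [A|].
    rewrite /E [in RHS]big_mkcond [in LHS]big_mkcond /=; congr ('C(_, j)%:R).
    apply: eq_bigr => B _.
    by case: (B \subset A); rewrite ?muln1 ?muln0 //=; case: eqP.
  by apply: bin_degree_le_sum => B /eqP Bm; apply: bin_degree_le_subset; rewrite Bm.
have deg_f : set_degree_le (p ^ k - 1 + \sum_(i < r) m * (p ^ a i - 1)) f.
  apply: set_degree_leM; last first.
    by apply: set_degree_le_prod => i; apply: set_degree_le_alt_bin.
  by rewrite -[(p ^ k - 1)%N]mul1n; apply: set_degree_le_alt_bin.
(* As [0 < m], the empty set has no subset of size [m], so each [E i set0] is an empty sum. *)
have f0 : f set0 = 1.
  rewrite /f cards0 alt_bin_dvd // dvdn0 mul1r big1 // => i _.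
  rewrite alt_bin_dvd // /E big1 ?dvdn0 // => B /andP[].
  by rewrite subset0 => /eqP-> /eqP; rewrite cards0 => m0; rewrite -m0 in m_gt0.
have := set_degree_alternating_sum deg_f ltT.
rewrite (bigD1 set0) //= f0 cards0 mulr1 expr0.
case: (pickP [pred A : {set T} | (A != set0) && (f A != 0)]) => [A|f_eq0]; last first.
  rewrite big1 ?addr0 => [/eqP|A A_neq0]; first by rewrite oner_eq0.
  by have := f_eq0 A; rewrite /= A_neq0 /= => /negbFE/eqP->; rewrite mulr0.
move=> /andP[A_neq0 fA] _; exists A => //; split=> [|i].
  by move: fA; rewrite /f alt_bin_dvd //; case: (_ %| _)%N; rewrite ?mul0r ?eqxx.
move: fA; rewrite /f (bigD1 i) //= (alt_bin_dvd (a i)) //.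
by case: (_ %| E i A)%N; rewrite // mul0r mulr0 eqxx.
Qed.

(** * The [p]-adic valuation of binomial coefficients *)

(** A summation range independent of [n] lets the valuations of the three factorials in a binomial
    be compared term by term. *)
Lemma logn_fact_widen (p L n : nat) : prime p -> (n < p ^ L)%N ->
  logn p n`! = (\sum_(1 <= k < L) n %/ p ^ k)%N.
Proof.
move=> p_pr n_lt; rewrite logn_fact //.
have zero a b : (forall k, (a <= k)%N -> (n < p ^ k)%N) ->
    (\sum_(a <= k < b) n %/ p ^ k = 0)%N.
  by move=> lt_n; rewrite big_nat big1 // => k /andP[ak _]; rewrite divn_small ?lt_n.
have lt_n k : (n.+1 <= k)%N -> (n < p ^ k)%N.
  by move=> nk; rewrite (leq_trans nk) // ltnW // ltn_expl ?prime_gt1.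
have lt_L k : (L <= k)%N -> (n < p ^ k)%N.
  by move=> Lk; rewrite (leq_trans n_lt) // leq_pexp2l ?prime_gt0.
case: L n_lt lt_L => [|L] n_lt lt_L.
  have n0 : n = 0%N by case: n n_lt {zero lt_n lt_L}.
  by rewrite n0 !big_geq.
case: (leqP n.+1 L.+1) => [nL|Ln].
  by rewrite [RHS](big_cat_nat _ nL) //= (zero n.+1) ?addn0.
by rewrite (@big_cat_nat _ _ _ L.+1) ?(ltnW Ln) //= (zero L.+1) ?addn0.
Qed.

(* Legendre's formula: only the terms [p ^ k] with [s < k < s + a] can
   contribute to the valuation of the binomial, and each contributes at most
   [1]. *)
Lemma not_dvd_bin_exp (p s a n : nat) : prime p -> (p ^ s <= n < p ^ (s + a))%N ->
  ~~ (p ^ a %| 'C(n, p ^ s))%N.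
Proof.
move=> p_pr /andP[le_n n_lt].
have p_gt1 := prime_gt1 p_pr; have p_gt0 := prime_gt0 p_pr.
have a_gt0 : (0 < a)%N.
  by rewrite -(ltn_add2l s) addn0 -(ltn_exp2l _ _ p_gt1) (leq_ltn_trans le_n).
rewrite pfactor_dvdn ?bin_gt0 // -ltnNge.
have := congr1 (logn p) (bin_fact le_n).
rewrite lognM ?muln_gt0 ?bin_gt0 ?fact_gt0 // lognM ?fact_gt0 //.
rewrite !(@logn_fact_widen p (s + a)) ?(leq_ltn_trans (leq_subr _ _) n_lt) //;
  last by rewrite (leq_ltn_trans le_n).
rewrite -big_split /= => logC.
have carries : (\sum_(1 <= k < s + a) (s < k) < a)%N.
  rewrite (@big_cat_nat _ _ _ s.+1) //=; last by rewrite -addn1 leq_add2l.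
  rewrite big_nat big1 ?add0n => [|k /andP[_ ks]]; last by rewrite ltnNge -ltnS ks.
  rewrite big_nat (eq_bigr (fun=> 1%N)) => [|k /andP[-> _] //].
  by rewrite -big_nat sum_nat_const_nat muln1 subnS addKn prednK.
set W := (\sum_(1 <= k < s + a) (_ + _))%N in logC.
rewrite -(ltn_add2r W) logC.
apply: leq_ltn_trans (_ : \sum_(1 <= k < s + a) (s < k) + W < _)%N;
  last by rewrite ltn_add2r.
rewrite -big_split leq_sum // => k _ /=; rewrite -{1}(subnKC le_n).
(* For [s < k] adding the two quotients loses at most [1]; for [k <= s] nothing is lost, as [p ^ k]
   divides [p ^ s]. *)
case: ltnP => [_|ks]; first by rewrite add1n -addn1 leq_divDl.
by rewrite add0n divnDl // dvdn_exp2l.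
Qed.

(** * Elementary symmetric values of sequences *)

(** Taking images under the injection [f] from positions to entries matches sets of positions with
    subsets of [s]. This identifies [elem_sym] of a selected subsequence with the sums in
    [exists_subset_dvd]. *)
Lemma elem_sym_map (R : comPzRingType) (I : finType) (m : nat) (g : I -> R)
    (s : seq I) : uniq s ->
  elem_sym m [seq g i | i <- s] =
    \sum_(B : {set I} | (B \subset s) && (#|B| == m)) \prod_(i in B) g i.
Proof.
move=> s_uniq; set S := map g s; have szS : size S = size s by rewrite size_map.
pose f (j : 'I_(size S)) : I := tnth (in_tuple s) (cast_ord szS j).
have f_inj : injective f.
  move=> i j /eqP; rewrite /f !(tnth_nth (f i)) nth_uniq ?size_tuple //= -?szS //.
  by move/eqP/val_inj.
have fE (j : 'I_(size S)) : S`_j = g (f j).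
  by rewrite (nth_map (f j)) -?szS // [in RHS]/f (tnth_nth (f j)).
have f_mem j : f j \in s by apply: mem_tnth.
rewrite /elem_sym [RHS](reindex_onto (fun A : {set 'I_(size S)} => f @: A)
  (fun B : {set I} => f @^-1: B)) /=.
  apply: eq_big => [A|A _]; last first.
    rewrite big_imset /=; last by move=> i j _ _ /f_inj.
    by apply: eq_bigr => j _; rewrite fE.
  rewrite card_imset // andbAC; case: (#|A| == m); rewrite ?andbF ?andbT //.
  symmetry; apply/andP; split; first by apply/subsetP=> _ /imsetP[j _ ->].
  by apply/eqP/setP=> j; rewrite inE mem_imset.
move=> B /andP[/subsetP Bs _]; apply/setP=> x; apply/imsetP/idP => [[j]|xB].
  by rewrite inE => ? ->.
have xs : (index x s < size S)%N by rewrite szS index_mem Bs.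
have fx : f (Ordinal xs) = x by rewrite /f (tnth_nth x) nth_index ?Bs.
by exists (Ordinal xs); rewrite ?inE fx.
Qed.

Lemma sub_in_count (T : eqType) (a1 a2 : pred T) (s : seq T) :
  {in s, forall x, a1 x -> a2 x} -> (count a1 s <= count a2 s)%N.
Proof.
move=> a12; rewrite (@eq_in_count _ a1 (predI a1 a2)) => [|x xs /=].
  by apply: sub_count => x /andP[].
by case a1x: (a1 x); rewrite ?(a12 _ xs a1x).
Qed.

Section PsumSequences.
Variables (p r : nat) (alpha : 'I_r -> nat).
Hypotheses (p_prime : prime p) (alpha_gt0 : forall i, (0 < alpha i)%N).
Local Notation G := (psum p alpha).

Lemma Zexp_natr_eq0 i n : (n%:R == 0 :> 'Z_(p ^ alpha i)) = (p ^ alpha i %| n)%N.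
Proof.
(* Only above [1] is the modulus of ['Z_(p ^ alpha i)] really [p ^ alpha i]. *)
have q_gt1 : (1 < p ^ alpha i)%N.
  by rewrite -(exp1n (alpha i)) ltn_exp2r ?prime_gt1.
by rewrite -val_eqE /= val_Zp_nat.
Qed.

Lemma psum_sumE (I : Type) (s : seq I) (P : pred I) (F : I -> G) i :
  (\sum_(j <- s | P j) F j) i = \sum_(j <- s | P j) F j i.
Proof. by apply: (big_morph (fun x : G => x i)) => [x y|]; rewrite ffunE. Qed.

Lemma psum_prodE (I : Type) (s : seq I) (P : pred I) (F : I -> G) i :
  (\prod_(j <- s | P j) F j) i = \prod_(j <- s | P j) F j i.
Proof. by apply: (big_morph (fun x : G => x i)) => [x y|]; rewrite ffunE. Qed.

Lemma exists_subseq_elem_sym_eq0 (k m : nat) (S : seq G) : (0 < m)%N ->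
  (p ^ k + \sum_(i < r) m * (p ^ alpha i - 1) <= size S)%N ->
  exists S' : seq G, [/\ subseq S' S, (0 < size S')%N, (p ^ k %| size S')%N
    & elem_sym m S' = 0].
Proof.
move=> m_gt0 leS.
(* The coordinates are lifted to their natural representatives before multiplying. *)
pose w i (B : {set 'I_(size S)}) : nat := (\prod_(j in B) ((S`_j)%R i : nat))%N.
have ltS : (p ^ k - 1 + \sum_(i < r) m * (p ^ alpha i - 1) < #|'I_(size S)|)%N.
  by rewrite card_ord (leq_trans _ leS) // -addSn subn1 prednK ?expn_gt0 ?prime_gt0.
have [A A_neq0 [dvdA dvdw]] := exists_subset_dvd w p_prime m_gt0 ltS.
have SE : S = [seq S`_j | j : 'I_(size S) <- enum 'I_(size S)].
  by rewrite (map_comp (nth 0 S) val) val_enum_ord map_nth_iota0 ?take_size.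
exists [seq S`_j | j : 'I_(size S) <- enum A]; rewrite size_map -cardE.
split=> //; [|by rewrite card_gt0|].
  by rewrite [X in subseq _ X]SE map_subseq // enumT; apply: filter_subseq.
rewrite elem_sym_map ?enum_uniq //; apply/ffunP=> i; rewrite psum_sumE psum0E.
apply/eqP; move: (dvdw i); rewrite -Zexp_natr_eq0; congr (_ == _).
rewrite natr_sum; apply: eq_big => [B|B _].
  by congr (_ && _); apply: eq_subset_r => j; rewrite mem_enum.
rewrite psum_prodE natr_prod; apply: eq_bigr => j _; exact: natr_Zp.
Qed.

(** A product of values [0] and [1] survives only when all its positions satisfy [P], so [elem_sym]
    counts the [m]-subsets of those positions. *)
Lemma elem_sym_indicator (m : nat) (S : seq G) (i : 'I_r) (P : pred G) :
  {in S, forall x : G, x i = (P x)%:R} ->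
  elem_sym m S i = ('C(count P S, m))%:R.
Proof.
move=> SP; rewrite psum_sumE.
pose X := [set j : 'I_(size S) | P S`_j].
have -> : count P S = #|X|.
  rewrite -sum1_card -sum1_count (big_nth 0) big_mkord.
  by apply: eq_bigl => j; rewrite inE.
rewrite -cards_draws -sum1_card natr_sum big_mkcond [RHS]big_mkcond /=.
apply: eq_bigr => A _; rewrite inE andbC; case: (#|A| == m) => //=.
rewrite psum_prodE (eq_bigr (fun j => (P S`_(nat_of_ord j))%:R)); last first.
  by move=> j _; rewrite SP ?mem_nth.
case: (boolP (A \subset X)) => [/subsetP AX|/subsetPn[j jA]].
  by rewrite big1 // => j /AX; rewrite inE => ->.
by rewrite inE (bigD1 j) //= => /negbTE->; rewrite mul0r.
Qed.

(** * The extremal sequences *)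

Definition stair (j : 'I_r) : G := psum_mk (fun i => ((j <= i)%N)%:R).

Lemma stairE j i : stair j i = ((j <= i)%N)%:R.
Proof. by rewrite ffunE. Qed.

Lemma psum_natr_bool_inj i (b c : bool) :
  (b%:R == c%:R :> 'Z_(p ^ alpha i)) = (b == c).
Proof.
have n1 : (1 == 0 :> 'Z_(p ^ alpha i)) = false.
  by rewrite (Zexp_natr_eq0 i 1) dvdn1 -(expn0 p) eqn_exp2l ?prime_gt1 // gtn_eqF.
by case: b c => [] []; rewrite ?eqxx // ?n1 // eq_sym n1.
Qed.

Lemma stair_inj : injective stair.
Proof.
move=> j k jk; apply/val_inj/eqP; rewrite eqn_leq.
have /eqP := congr1 (fun x : G => x k) jk.
have /eqP := congr1 (fun x : G => x j) jk.
by rewrite !stairE !psum_natr_bool_inj !leqnn => /eqP<- /eqP->.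
Qed.

Lemma stair_neq0 j : stair j != 0.
Proof.
apply/eqP=> /(congr1 (fun x : G => x j))/eqP.
by rewrite stairE leqnn psum0E (psum_natr_bool_inj j true false).
Qed.

Definition stair_mult (m : nat) (j : 'I_r) : nat :=
  (m * (p ^ alpha j - 1) + (j == 0 :> nat) * (m - 1))%N.

Definition stair_seq (m z : nat) : seq G :=
  flatten [seq nseq (stair_mult m j) (stair j) | j <- enum 'I_r] ++ nseq z 0.

Lemma size_stair_seq (m z : nat) : (0 < r)%N ->
  size (stair_seq m z) = (\sum_(i < r) m * (p ^ alpha i - 1) + (m - 1) + z)%N.
Proof.
move=> r_gt0; rewrite size_cat size_nseq size_flatten /shape sumnE 2!big_map big_enum /=.
under eq_bigr do rewrite size_nseq; rewrite big_split /=; congr (_ + _ + _)%N.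
rewrite (bigD1 (Ordinal r_gt0)) //= mul1n big1 ?addn0 // => j j_neq0.
by rewrite (_ : (j == 0 :> nat) = false) //; apply: negbTE.
Qed.

Lemma count_stair_seq (m z : nat) (x : G) : count_mem x (stair_seq m z) =
  (\sum_(j < r) stair_mult m j * (stair j == x) + z * (0%R == x))%N.
Proof.
rewrite count_cat count_flatten sumnE 2!big_map big_enum count_nseq.
congr (_ + _)%N; last exact: mulnC.
by apply: eq_bigr => j _; rewrite count_nseq mulnC.
Qed.

Lemma count_stair_seq_stair (m z : nat) j :
  count_mem (stair j) (stair_seq m z) = stair_mult m j.
Proof.
rewrite count_stair_seq (bigD1 j) //= eqxx muln1 big1 => [|i ij].
  by rewrite eq_sym (negbTE (stair_neq0 j)) muln0 !addn0.
by rewrite (inj_eq stair_inj) (negbTE ij) muln0.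
Qed.

Lemma count_stair_seq0 (m z : nat) : count_mem 0 (stair_seq m z) = z.
Proof.
rewrite count_stair_seq eqxx muln1 big1 // => i _.
by rewrite (negbTE (stair_neq0 i)) muln0.
Qed.

Lemma mem_stair_seq (m z : nat) x :
  x \in stair_seq m z -> x = 0 \/ exists j, x = stair j.
Proof.
rewrite mem_cat => /orP[/flatten_mapP[j _]|]; rewrite mem_nseq => /andP[_ /eqP->].
  by right; exists j.
by left.
Qed.

(* If [e_(p ^ s)] vanishes then, by induction on [k], fewer than [p ^ s] terms
   have [k]-th coordinate [1]: their number [c] satisfies
   [c < p ^ (s + alpha k)], and [p ^ alpha k] divides [binomial c (p ^ s)]. *)
Lemma stair_seq_zero_sum (s z : nat) (S : seq G) : (0 < r)%N ->
  submultiset S (stair_seq (p ^ s) z) -> elem_sym (p ^ s) S = 0 ->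
  (size S < p ^ s + z)%N.
Proof.
move=> r_gt0 sub e0; set m := (p ^ s)%N.
have m_gt0 : (0 < m)%N by rewrite expn_gt0 prime_gt0.
have memS x : x \in S -> x = 0 \/ exists j, x = stair j.
  move=> xS; apply: (@mem_stair_seq m z); move: xS.
  by rewrite -!has_pred1 !has_count => /leq_trans; apply.
have val01 (i : 'I_r) : {in S, forall x : G, x i = (x i == 1)%:R}.
  move=> x /memS[->|[j ->]]; rewrite ?psum0E ?stairE.
    by rewrite (psum_natr_bool_inj i false true).
  by rewrite (psum_natr_bool_inj i _ true); case: (_ <= _)%N.
pose c (i : 'I_r) := count (fun x : G => x i == 1) S.
(* Coordinate [i] of [elem_sym] is ['C(c i, p ^ s)], to which [not_dvd_bin_exp] applies. *)
have c_small i : (c i < m * p ^ alpha i)%N -> (c i < m)%N.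
  move=> c_lt; have := congr1 (fun x : G => x i) e0.
  rewrite (elem_sym_indicator _ (val01 i)) psum0E => /eqP.
  rewrite Zexp_natr_eq0; apply: contraTT; rewrite -leqNgt => c_ge.
  by rewrite not_dvd_bin_exp // c_ge expnD.
have mult_le j : (count_mem (stair j) S <= stair_mult m j)%N.
  by rewrite -(count_stair_seq_stair m z); apply: sub.
have mM i : (m * (p ^ alpha i - 1) + m = m * p ^ alpha i)%N.
  by rewrite mulnBr muln1 subnK // leq_pmulr // expn_gt0 prime_gt0.
have c_lt : forall k (k_lt : (k < r)%N), (c (Ordinal k_lt) < m)%N.
  elim=> [|k IHk] k_lt; apply: c_small; rewrite -mM.
    (* Only [stair 0] has a [1] in coordinate [0], and it occurs at most [m * p ^ alpha 0 - 1]
       times. *)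
    apply: (@leq_ltn_trans (stair_mult m (Ordinal k_lt))); last first.
      by rewrite /stair_mult mul1n ltn_add2l subn1 prednK.
    apply: leq_trans (mult_le _); apply: sub_in_count => x /memS[->|[j ->]] /=.
      by rewrite psum0E (psum_natr_bool_inj _ false true).
    rewrite stairE (psum_natr_bool_inj _ _ true) eqb_id leqn0 => /eqP j0.
    by rewrite (inj_eq stair_inj) -val_eqE /= j0.
  (* A term with a [1] in coordinate [k.+1] either is the stair starting there or already has a [1]
     in coordinate [k]. *)
  have k_lt' := ltnW k_lt.
  apply: (@leq_ltn_trans (stair_mult m (Ordinal k_lt) + c (Ordinal k_lt'))); last first.
    by rewrite /stair_mult mul0n addn0 ltn_add2l IHk.
  apply: leq_trans (leq_add (mult_le _) (leqnn _)).
  rewrite -count_predUI; apply: leq_trans (leq_addr _ _).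
  apply: sub_in_count => x /memS[->|[j ->]] /=.
    by rewrite psum0E (psum_natr_bool_inj _ false true).
  rewrite !stairE !(psum_natr_bool_inj _ _ true) !eqb_id leq_eqVlt => /orP[j_eq|].
    by rewrite (inj_eq stair_inj) -val_eqE /= j_eq.
  by rewrite ltnS => ->; rewrite orbT.
(* Every stair is [1] in the last coordinate, so the terms not counted by [c] there are zeros, at
   most [z] of them. *)
have r1_lt : (r.-1 < r)%N by rewrite prednK.
rewrite -(count_predC (fun x : G => x (Ordinal r1_lt) == 1) S).
apply: (@leq_trans (m + count_mem 0 S)); last first.
  by rewrite leq_add2l -(count_stair_seq0 m z); apply: sub.
rewrite -addSn leq_add ?c_lt //; apply: sub_in_count => x /memS[->|[j ->]] //=.
by rewrite stairE (psum_natr_bool_inj _ _ true) /= -ltnS prednK // ltn_ord.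
Qed.
End PsumSequences.

Local Close Scope ring_scope.

Theorem corollary2p22 (p r s : nat) (alpha : 'I_r -> nat)
    (p_prime : prime p) (r_gt0 : 0 < r) (alpha_gt0 : forall i, 0 < alpha i)
    (h : nat) (h_def : h = \sum_(i < r) alpha i)
    (h_large : \sum_(j < r) p ^ s * (p ^ alpha j - 1) < p ^ h) :
  exists2 d : nat, davenport (psum p alpha) (p ^ s) = Some d
    & EGZ (p ^ h) (psum p alpha) (p ^ s) = Some (p ^ h + d - p ^ s).
Proof.
set N := \sum_(j < r) _ in h_large.
have exp_gt0 k : 0 < p ^ k by rewrite expn_gt0 prime_gt0.
have ps_gt0 := exp_gt0 s.
(* A single summand of [N] is already at least [p ^ s]; this keeps the subtraction [p ^ h - p ^ s]
   from truncating. *)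
have lt_ps_ph : p ^ s < p ^ h.
  apply: leq_ltn_trans h_large; rewrite /N (bigD1 (Ordinal r_gt0)) //=.
  apply: leq_trans (leq_addr _ _); rewrite leq_pmulr // subn_gt0.
  by rewrite -{1}(expn0 p) ltn_exp2l ?prime_gt1.
have sub_submultiset (S' S : seq (psum p alpha)) : subseq S' S -> submultiset S' S.
  by move=> sub x; apply: leq_count_subseq.
exists (p ^ s + N); apply/least_pos_Some; split.
- by rewrite addn_gt0 ps_gt0.
- move=> S le_S.
  have [S' [sub S'_gt0 dvdS' e0]] :=
    exists_subseq_elem_sym_eq0 p_prime alpha_gt0 ps_gt0 le_S.
  by exists S'; split; [apply: sub_submultiset | apply: dvdn_leq |].
- move=> k k_gt0 Pk; rewrite leqNgt; apply/negP=> k_lt.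
  have [|S' [sub le_S' e0]] := Pk (stair_seq p alpha (p ^ s) 0).
    by rewrite size_stair_seq // addn0 addnC -ltnS -addSn subn1 prednK.
  have := stair_seq_zero_sum p_prime alpha_gt0 r_gt0 sub e0.
  by rewrite addn0 ltnNge le_S'.
- by rewrite addnCA addKn addn_gt0 exp_gt0.
- rewrite addnCA addKn => S le_S.
  (* Cutting [S] to exactly [p ^ h + N < 2 * p ^ h] terms leaves [p ^ h] as the only positive
     multiple of [p ^ h] that [size S'] can be. *)
  have le_take : p ^ h + N <= size (take (p ^ h + N) S) by rewrite size_takel.
  have [S' [sub S'_gt0 /dvdnP[q szS'] e0]] :=
    exists_subseq_elem_sym_eq0 p_prime alpha_gt0 ps_gt0 le_take.
  exists S'; split=> //.
    exact/sub_submultiset/(subseq_trans sub)/take_subseq.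
  have := size_subseq sub; rewrite size_takel // szS'.
  case: q szS' S'_gt0 => [->//|[|q]] szS' _; first by rewrite mul1n.
  by rewrite !mulSn leq_add2l leqNgt (leq_trans h_large) // leq_addr.
- move=> k k_gt0 Pk; rewrite addnCA addKn leqNgt; apply/negP=> k_lt.
  (* With [p ^ h - p ^ s] zeros the length is [p ^ h + N - 1], and [stair_seq_zero_sum] gives
     [size S' < p ^ h]. *)
  have [|S' [sub szS' e0]] := Pk (stair_seq p alpha (p ^ s) (p ^ h - p ^ s)).
    rewrite size_stair_seq // -ltnS (leq_trans k_lt) // -/N.
    by rewrite -addSn -addnS subn1 prednK // -addnA subnKC ?(ltnW lt_ps_ph) // addnC.
  have := stair_seq_zero_sum p_prime alpha_gt0 r_gt0 sub e0.
  by rewrite szS' subnKC ?ltnn // ltnW.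
Qed.
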